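(* Let $x=(x_1,\dots,x_T)$ be a path with $P^{\mathrm{obs}}(X=x)>0$ and suppose $P^{\mathrm{obs}}(Y=y^j\mid X=x)=p_j>0$, $j=1,\dots,J$, with $y^1,\dots,y^J\in\mathbb R^T$ distinct and $\sum_jp_j=1$. Let $\theta=(b_0,b_1,r)$ with $r>0$, put $z_{j0t}(\theta)=y_t^j-x_t'b_0$ and $z_{j1t}(\theta)=(y_t^j-x_t'b_1)/r$, and let $v_1<\dots<v_P$ be the distinct values among the $2TJ$ numbers $z_{j\ell t}(\theta)$. Consider the linear feasibility problem in $(q_{jp})$: $$q_{jp}\ge0\ (j\le J,p\le P),\qquad\sum_{p=1}^Pq_{jp}=p_j\ (j\le J),$$ $$\sum_{j=1}^Jq_{jp}\{\mathbf 1(z_{j\ell t}(\theta)\le v_p)-q_\ell\}\ge0,\qquad\sum_{j=1}^Jq_{jp}\{q_\ell-\mathbf 1(z_{j\ell t}(\theta)<v_p)\}\ge0\qquad(\ell=0,1,\ t\le T,\ p\le P).$$ Then, for the path $X=x$, a joint median–$\tau$ coupling exists for $\theta$ if and only if this linear problem is feasible. Thus, when $X$ has finite support and each conditional law of $Y$ given a positive-probability path has finite support, $\theta\in\Theta_I^{0,\tau}$ if and only if the linear problem is feasible for every positive-probability path of $X$.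
   Context: $T,k\ge1$ are integers, $\tau\in(0,1)$, $\tau\ne1/2$, and the quantile constants (single subscript) are $q_0=1/2$, $q_1=\tau$; the unknown masses (double subscript) are $q_{jp}$. $P^{\mathrm{obs}}$ is the law of $(Y,X)$, $Y\in\mathbb R^T$, $X=(X_1,\dots,X_T)$, $X_t\in\mathbb R^k$. Let $Z_{0t}(\theta)=Y_t-X_t'b_0$, $Z_{1t}(\theta)=(Y_t-X_t'b_1)/r$. $\Theta_I^{0,\tau}$ is the set of $\theta=(b_0,b_1,r)\in\mathbb R^k\times\mathbb R^k\times(0,\infty)$ for which there is a Borel probability law $\pi$ of $(Y,X,A)$, $A\in\mathbb R$, with $(Y,X)$-marginal $P^{\mathrm{obs}}$, such that $\pi$-a.s., for $\ell=0,1$ and all $t\le T$, $\pi\{Z_{\ell t}(\theta)\le A\mid X,A\}\ge q_\ell$ and $\pi\{Z_{\ell t}(\theta)<A\mid X,A\}\le q_\ell$. A joint median–$\tau$ coupling for the path $x$ and candidate $\theta$ is a Borel probability law $\pi_x$ of $(Y,A)\in\mathbb R^T\times\mathbb R$ whose $Y$-marginal is the conditional law of $Y$ given $X=x$ and such that, $\pi_x$-a.s. for $\ell=0,1$ and $t\le T$, with $Z_{\ell t}(\theta)$ evaluated at $X=x$, $\pi_x\{Z_{\ell t}(\theta)\le A\mid A\}\ge q_\ell$ and $\pi_x\{Z_{\ell t}(\theta)<A\mid A\}\le q_\ell$. *)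

(* Defs.v *)
From HB Require Import structures.
From mathcomp Require Import all_boot all_order all_algebra.
From mathcomp Require Import all_classical all_reals all_analysis.

Set Implicit Arguments.
Unset Strict Implicit.
Unset Printing Implicit Defensive.

Import Order.TTheory GRing.Theory Num.Theory.
Import numFieldNormedType.Exports.

Local Open Scope classical_set_scope.
Local Open Scope ring_scope.

(* Every [n.-tuple R] carries the product sigma-algebra, i.e. the Borel sets of
   R^n; a path is a T-tuple of k-tuples. *)
Notation outcome R T := (T.-tuple R).
Notation covpath R T k := (T.-tuple (k.-tuple R)).

(* ((b0, b1), r) *)
Notation param R k := (k.-tuple R * k.-tuple R * R)%type.

Section ConditionalProbability.
Context (R : realType) d d' (Omega : measurableType d) (S : measurableType d').

(* [h \o C] is a version of the conditional probability of E given the random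
   element C under P. Versions exist and any two agree P-almost surely. *)
Definition is_cond_prob (P : probability Omega R) (C : Omega -> S)
    (E : set Omega) (h : S -> R) : Prop :=
  [/\ measurable_fun [set: S] h,
      P.-integrable [set: Omega] (fun w => (h (C w))%:E) &
      forall B, measurable B ->
        (\int[P]_(w in C @^-1` B) (h (C w))%:E = P (E `&` C @^-1` B))%E].

(* P-a.s., for all l and t, P{Z_lt <= A | C} >= q_l and P{Z_lt < A | C} <= q_l *)
Definition quantile_restrictions (T : nat) (q : 'I_2 -> R)
    (P : probability Omega R) (Z : 'I_2 -> 'I_T -> Omega -> R)
    (A : Omega -> R) (C : Omega -> S) : Prop :=
  exists hle hlt : 'I_2 -> 'I_T -> S -> R,
  [/\ forall l t, is_cond_prob P C [set w | Z l t w <= A w] (hle l t),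
      forall l t, is_cond_prob P C [set w | Z l t w < A w] (hlt l t) &
      {ae P, forall w, forall l t,
         q l <= hle l t (C w) /\ hlt l t (C w) <= q l}].

End ConditionalProbability.

Section Model.
Context (R : realType) (T k : nat).
Implicit Types (theta : param R k) (x : covpath R T k) (y : outcome R T).

Definition dot (u v : k.-tuple R) : R := \sum_(i < k) tnth u i * tnth v i.

Definition qconst (tau : R) (l : 'I_2) : R :=
  if l == ord0 then 1 / 2 else tau.

(* Z_{lt}(theta) at (Y, X) = (y, x); with y = y^j this is z_{jlt}(theta). *)
Definition zval theta (l : 'I_2) (t : 'I_T) y x : R :=
  let: (b0, b1, r) := theta in
  if l == ord0 then tnth y t - dot (tnth x t) b0
  else (tnth y t - dot (tnth x t) b1) / r.

Definition Theta_I (tau : R)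
    (Pobs : probability (outcome R T * covpath R T k)%type R) : set (param R k) :=
  [set theta | 0 < theta.2 /\
    exists pi : probability ((outcome R T * covpath R T k) * R)%type R,
      (forall B, measurable B -> pi (B `*` [set: R]) = Pobs B) /\
      quantile_restrictions (qconst tau) pi
        (fun l t w => zval theta l t w.1.1 w.1.2)
        (fun w => w.2) (fun w => (w.1.2, w.2))].

Definition probX (Pobs : probability (outcome R T * covpath R T k)%type R) x : R :=
  fine (Pobs [set w | w.2 = x]).

(* Elementary conditional law of Y given X = x, meaningful when
   [0 < probX Pobs x]. *)
Definition cond_law (Pobs : probability (outcome R T * covpath R T k)%type R) x
    (B : set (outcome R T)) : R :=
  fine (Pobs [set w | B w.1 /\ w.2 = x]) / probX Pobs x.

Definition joint_coupling (tau : R)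
    (Pobs : probability (outcome R T * covpath R T k)%type R) x theta
    (pi : probability (outcome R T * R)%type R) : Prop :=
  (forall B, measurable B -> pi (B `*` [set: R]) = (cond_law Pobs x B)%:E) /\
  quantile_restrictions (qconst tau) pi
    (fun l t w => zval theta l t w.1 x) (fun w => w.2) (fun w => w.2).

(* y enumerates, without repetition, the atoms of the law of Y given X = x, and
   p their masses. *)
Definition cond_atoms (Pobs : probability (outcome R T * covpath R T k)%type R) x
    (J : nat) (y : 'I_J -> outcome R T) (p : 'I_J -> R) : Prop :=
  [/\ injective y, forall j, 0 < p j,
      forall j, cond_law Pobs x [set y j] = p j & \sum_(j < J) p j = 1].

(* v_1 < ... < v_P, with P the size of the sequence *)
Definition breakpoints theta x (J : nat) (y : 'I_J -> outcome R T) : seq R :=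
  sort <=%R (undup
    [seq zval theta w.1.2 w.2 (y w.1.1) x | w : 'I_J * 'I_2 * 'I_T]).

Definition lp_feasible (tau : R) theta x (J : nat) (y : 'I_J -> outcome R T)
    (p : 'I_J -> R) : Prop :=
  let v := breakpoints theta x y in
  exists q : 'I_J -> 'I_(size v) -> R,
  [/\ forall j s, 0 <= q j s,
      forall j, \sum_s q j s = p j,
      forall (l : 'I_2) (t : 'I_T) s,
        0 <= \sum_j q j s *
               ((zval theta l t (y j) x <= v`_s)%R%:R - qconst tau l) &
      forall (l : 'I_2) (t : 'I_T) s,
        0 <= \sum_j q j s *
               (qconst tau l - (zval theta l t (y j) x < v`_s)%R%:R)].

Definition finite_support_X
    (Pobs : probability (outcome R T * covpath R T k)%type R) : Prop :=
  exists2 S : set (covpath R T k), finite_set S & Pobs [set w | S w.2] = 1%E.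

Definition finite_cond_support
    (Pobs : probability (outcome R T * covpath R T k)%type R) x : Prop :=
  exists2 S : set (outcome R T), finite_set S & cond_law Pobs x S = 1.

End Model.

(* Main.v *)
Require Import Defs.
From HB Require Import structures.
From mathcomp Require Import all_boot all_order all_algebra.
From mathcomp Require Import all_classical all_reals all_analysis.
From mathcomp Require Import measurable_realfun ring lra.

Set Implicit Arguments.
Unset Strict Implicit.
Unset Printing Implicit Defensive.

Import Order.TTheory GRing.Theory Num.Theory.
Import numFieldNormedType.Exports.

Local Open Scope classical_set_scope.
Local Open Scope ring_scope.

(* Only floors matter: if v_s is the largest breakpoint below A, then
   1(z <= A) = 1(z <= v_s) and 1(z < v_s) <= 1(z < A) for every breakpoint z, so
   pushing the mass of a coupling from A down to v_s turns the conditional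
   quantile restrictions, integrated over {floor A = v_s}, into the linear
   constraints. No mass lies below v_1, since there 1(z <= A) = 0 while the
   median restriction asks for a conditional probability of at least 1/2.
   Conversely, a feasible q puts mass q_js on (y^j, v_s); under this finitely
   supported law conditional probabilities are ratios of sums of masses over
   fibres of the conditioning variable. For Theta_I these laws are glued with
   weights P(X = x) over the finite support of X. *)

(** * Measurability of singletons and of finite sets *)

Lemma set_mem_cons (T : eqType) (a : T) (s : seq T) :
  [set` a :: s] = [set a] `|` [set` s].
Proof.
apply/seteqP; split=> b /=; rewrite inE.
  by move=> /orP[/eqP ->|bs]; [left|right].
by move=> [->|bs]; apply/orP; [left|right].
Qed.

Lemma measurable_tuple_set1 d (S : measurableType d) n (u : n.-tuple S) :
  (forall a : S, measurable [set a]) -> measurable [set u].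
Proof.
move=> mS.
rewrite (_ : [set u] =
    \bigcap_(i in [set: 'I_n]) ((@tnth n S)^~ i @^-1` [set tnth u i])).
  apply: fin_bigcap_measurable => // i _.
  by rewrite -[X in measurable X]setTI; apply: measurable_tnth.
apply/seteqP; split => [_ -> i _ //|v uv].
by apply/eq_from_tnth => i; exact: uv.
Qed.

Lemma measurable_pair_set1 d d' (S : measurableType d) (S' : measurableType d')
    (u : S * S') :
  measurable [set u.1] -> measurable [set u.2] -> measurable [set u].
Proof.
move=> m1 m2; rewrite (_ : [set u] = [set u.1] `*` [set u.2]).
  exact: measurableX.
by apply/seteqP; split => [_ -> //|[a b] [/= -> ->]]; case: u {m1 m2}.
Qed.

Lemma measurable_set_mem d (S : measurableType d) (s : seq S) :
  (forall a : S, measurable [set a]) -> measurable [set` s].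
Proof.
move=> mS; elim: s => [|a s IHs]; first by rewrite set_nil.
by rewrite set_mem_cons; apply: measurableU.
Qed.

(** * Finite additivity with real-valued probabilities *)

Section RealProbability.
Context d (Omega : measurableType d) (R : realType) (P : probability Omega R).

Lemma prob_ge0 (E : set Omega) : 0 <= fine (P E).
Proof. exact: fine_ge0. Qed.

Lemma prob_le (E F : set Omega) : measurable E -> measurable F -> E `<=` F ->
  fine (P E) <= fine (P F).
Proof.
move=> mE mF EF; apply: fine_le; rewrite ?fin_num_measure//.
by apply: le_measure; rewrite ?inE.
Qed.

Lemma probU (E F : set Omega) : measurable E -> measurable F ->
  E `&` F = set0 -> fine (P (E `|` F)) = fine (P E) + fine (P F).
Proof.
by move=> mE mF EF; rewrite measureU// fineD// fin_num_measure.
Qed.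

(** By additivity the part of [D] outside [F] is null, so cutting any event inside [D] down to [F]
    loses no mass. *)
Lemma prob_setI_full (D F E : set Omega) :
  measurable D -> measurable F -> measurable E ->
  fine (P (D `&` F)) = fine (P D) ->
  fine (P (D `&` E)) = fine (P (D `&` E `&` F)).
Proof.
move=> mD mF mE DF; apply/eqP; rewrite eq_le; apply/andP; split; last first.
  by apply: prob_le => [||w [] //]; repeat apply: measurableI.
have mDF : measurable (D `&` ~` F) by apply: measurableI => //; exact: measurableC.
have DF0 : fine (P (D `&` ~` F)) = 0.
  apply: (@addrI _ (fine (P (D `&` F)))); rewrite addr0 -probU//.
  - by rewrite -setIUr setUv setIT.
  - exact: measurableI.
  - by rewrite setIACA setICr setI0.
have mDEF : measurable (D `&` E `&` F) by do 2 apply: measurableI => //.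
rewrite -[leRHS]addr0 -DF0 -probU//; last first.
  by rewrite setIACA setICr setI0.
apply: prob_le; [exact: measurableI|exact: measurableU|] => w [Dw Ew].
by have [Fw|Fw] := pselect (F w); [left|right].
Qed.

(** Serves to split an event along the atoms of the outcome, along the floors of A, and along the
    support of the path. *)
Lemma prob_partition d' (S : measurableType d') (Y : Omega -> S) (G : set Omega)
    (s : seq S) :
  measurable G -> measurable_fun [set: Omega] Y ->
  (forall a : S, measurable [set a]) -> uniq s ->
  fine (P (G `&` Y @^-1` [set` s])) =
  \sum_(a <- s) fine (P (G `&` Y @^-1` [set a])).
Proof.
move=> mG mY mS.
have mpre B : measurable B -> measurable (G `&` Y @^-1` B).
  by move=> mB; apply: measurableI => //; rewrite -[X in measurable X]setTI; exact: mY.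
elim: s => [_|a s IHs /= /andP[as_ us]].
  by rewrite set_nil preimage_set0 setI0 measure0 big_nil.
rewrite big_cons -IHs// set_mem_cons preimage_setU setIUr probU//.
- exact: mpre.
- exact/mpre/measurable_set_mem.
- apply/seteqP; split => // w [[_ /= ->] [_ /=]].
  by rewrite (negbTE as_).
Qed.

End RealProbability.

(** * Almost sure bounds on conditional probabilities, in integrated form *)

Section ConditionalBounds.
Context (R : realType) d d' (Omega : measurableType d) (S : measurableType d').
Variables (P : probability Omega R) (C : Omega -> S).
Hypothesis mC : measurable_fun [set: Omega] C.

Let mpreC B : measurable B -> measurable (C @^-1` B).
Proof. by move=> mB; rewrite -[X in measurable X]setTI; exact: mC. Qed.

(** The complement of the null exceptional set has full mass and lies in the preimage of [H], which
    therefore has mass one. *)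
Lemma prob_setI_ae (H : set S) (E : set Omega) : measurable H -> measurable E ->
  {ae P, forall w, H (C w)} -> fine (P E) = fine (P (E `&` C @^-1` H)).
Proof.
move=> mH mE [N [mN PN0 HN]].
rewrite -[in RHS](setTI E) -(prob_setI_full measurableT (mpreC mH) mE) ?setTI//.
apply/eqP; rewrite eq_le prob_le//=; last exact: mpreC.
have := probU P mN (measurableC mN).
rewrite setUv setICr PN0 add0r => ->//.
apply: prob_le; [exact: measurableC|exact: mpreC|] => w Nw.
by apply: contrapT => Hw; apply: Nw; exact: HN.
Qed.

Let cond_prob_integral (E : set Omega) (h : S -> R) (q : R) (B : set S) :
  is_cond_prob P C E h -> measurable B ->
  [/\ fine (P (E `&` C @^-1` B)) = fine (\int[P]_(w in C @^-1` B) (h (C w))%:E)%E,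
      q * fine (P (C @^-1` B)) = fine (\int[P]_(w in C @^-1` B) q%:E)%E,
      P.-integrable (C @^-1` B) (fun w => (h (C w))%:E) &
      P.-integrable (C @^-1` B) (fun w => q%:E)].
Proof.
move=> [mh ih hE] mB; have mCB := mpreC mB; split; first by rewrite hE.
- by rewrite lebesgue_integral_nonneg.integral_cstr// fineM// fin_num_measure.
- exact: (integrableS measurableT).
- exact: finite_measure_integrable_cst.
Qed.

(** The bound on [h] holds only almost surely. Cutting [B] down to the measurable set [H], where it
    holds everywhere, changes neither probability and lets the two integrals over [B] and [H] be
    compared pointwise. *)
Lemma cond_prob_le (E : set Omega) (h : S -> R) (q : R) (B : set S) :
  is_cond_prob P C E h -> measurable E -> measurable B ->
  {ae P, forall w, h (C w) <= q} ->
  fine (P (E `&` C @^-1` B)) <= q * fine (P (C @^-1` B)).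
Proof.
move=> hE mE mB hq; pose H := h @^-1` `]-oo, q].
have mH : measurable H.
  by case: hE => mh _ _; rewrite -[X in measurable X]setTI; apply: mh.
have HC : {ae P, forall w, H (C w)}.
  by apply: filterS hq => w; rewrite /H /= in_itv.
have mBH : measurable (B `&` H) by exact: measurableI.
have [Eh Eq ih iq] := cond_prob_integral q hE mBH.
rewrite (prob_setI_ae mH _ HC); last by apply: measurableI => //; exact: mpreC.
rewrite [in leRHS](prob_setI_ae mH _ HC); last exact: mpreC.
rewrite -setIA -preimage_setI Eh Eq.
apply: fine_le; try by apply: integrable_fin_num => //; exact: mpreC.
apply: le_integral => //; first exact: mpreC.
by move=> w; rewrite inE => -[_]; rewrite /H /= in_itv/= lee_fin.
Qed.

Lemma cond_prob_ge (E : set Omega) (h : S -> R) (q : R) (B : set S) :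
  is_cond_prob P C E h -> measurable E -> measurable B ->
  {ae P, forall w, q <= h (C w)} ->
  q * fine (P (C @^-1` B)) <= fine (P (E `&` C @^-1` B)).
Proof.
move=> hE mE mB hq; pose H := h @^-1` `[q, +oo[.
have mH : measurable H.
  by case: hE => mh _ _; rewrite -[X in measurable X]setTI; apply: mh.
have HC : {ae P, forall w, H (C w)}.
  by apply: filterS hq => w; rewrite /H /= in_itv/= andbT.
have mBH : measurable (B `&` H) by exact: measurableI.
have [Eh Eq ih iq] := cond_prob_integral q hE mBH.
rewrite (prob_setI_ae mH _ HC); last exact: mpreC.
rewrite [in leRHS](prob_setI_ae mH _ HC); last first.
  by apply: measurableI => //; exact: mpreC.
rewrite -setIA -preimage_setI Eh Eq.
apply: fine_le; try by apply: integrable_fin_num => //; exact: mpreC.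
apply: le_integral => //; first exact: mpreC.
by move=> w; rewrite inE => -[_]; rewrite /H /= in_itv/= andbT lee_fin.
Qed.

End ConditionalBounds.

(** * The floor of a real number in a finite list *)

Section Floor.
Context (R : realType).
Implicit Types (v : seq R) (a b z : R).

(* The largest element of [b :: v] that is at most [a], [b] playing the role of
   minus infinity. *)
Definition seq_floor b v a : R :=
  foldr (fun z m => if z <= a then Num.max z m else m) b v.

Lemma measurable_seq_floor b v : measurable_fun [set: R] (seq_floor b v).
Proof.
elim: v => [|z v IHv] /=; first exact: measurable_cst.
apply: measurable_fun_ifT => //; first exact: measurable_fun_ler.
exact: measurable_maxr.
Qed.

Lemma seq_floor_mem b v a : seq_floor b v a \in b :: v.
Proof.
elim: v => [|z v]; first by rewrite mem_head.
rewrite !inE /=; case: ifP => _; last by case/orP => ->; rewrite ?orbT.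
by case: (leP z) => _; rewrite ?eqxx ?orbT// => /orP[] ->; rewrite ?orbT.
Qed.

Lemma le_seq_floor b v a z : z \in v -> z <= a -> z <= seq_floor b v a.
Proof.
elim: v => // e v IHv; rewrite inE => /orP[/eqP -> /= ->|zv za /=].
  by rewrite le_max lexx.
by case: ifP => _; rewrite ?le_max IHv ?orbT.
Qed.

(** The value [b] is set apart because this default need not lie below [a]. *)
Lemma seq_floor_le b v a : seq_floor b v a != b -> seq_floor b v a <= a.
Proof.
elim: v => [|z v IHv] /=; first by rewrite eqxx.
by case: ifP => // za; case: (leP z).
Qed.

(** Provides a default for [seq_floor] strictly below every breakpoint, so that the floor equals [b]
    exactly when no breakpoint is at most [a]. *)
Lemma exists_lt_seq v : exists b, forall z, z \in v -> b < z.
Proof.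
elim: v => [|z v [b bv]]; first by exists 0.
exists (Num.min (z - 1) b) => e; rewrite inE gt_min => /orP[/eqP ->|/bv ->].
  by rewrite ltrBlDr ltrDl ltr01.
by rewrite orbT.
Qed.

End Floor.

Lemma mem_breakpoints (R : realType) T k (theta : param R k) x J
    (y : 'I_J -> outcome R T) l t j :
  zval theta l t (y j) x \in breakpoints theta x y.
Proof.
rewrite mem_sort mem_undup.
by apply/mapP; exists (j, l, t); rewrite ?mem_enum.
Qed.

Lemma breakpoints_uniq (R : realType) T k (theta : param R k) x J
    (y : 'I_J -> outcome R T) : uniq (breakpoints theta x y).
Proof. by rewrite sort_uniq undup_uniq. Qed.

(** * From quantile restrictions to the linear problem *)

Section Necessity.
Context (R : realType) (T k : nat) d d' (Omega : measurableType d)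
  (S : measurableType d').
Variables (P : probability Omega R) (Y : Omega -> outcome R T) (C : Omega -> S).
Variables (a : S -> R) (D : set S) (Z : 'I_2 -> 'I_T -> Omega -> R).
Variables (tau : R) (theta : param R k) (x : covpath R T k).
Variables (J : nat) (y : 'I_J -> outcome R T) (p : 'I_J -> R).
Hypotheses (mY : measurable_fun [set: Omega] Y)
  (mC : measurable_fun [set: Omega] C) (ma : measurable_fun [set: S] a)
  (mD : measurable D) (mZ : forall l t, measurable_fun [set: Omega] (Z l t)).
Hypothesis ZE : forall l t w, D (C w) -> Z l t w = zval theta l t (Y w) x.
Let c : R := fine (P (C @^-1` D)).
Hypotheses (c_gt0 : 0 < c) (y_inj : injective y)
  (Pp : forall j, fine (P (C @^-1` D `&` Y @^-1` [set y j])) = c * p j)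
  (p_sum : \sum_j p j = 1).

Let mset1Y (u : outcome R T) : measurable [set u].
Proof. exact: (measurable_tuple_set1 u (@measurable_set1 R)). Qed.

Let mpreY u : measurable (Y @^-1` [set u]).
Proof. by rewrite -[X in measurable X]setTI; exact: mY. Qed.

Let mpreC B : measurable B -> measurable (C @^-1` B).
Proof. by move=> mB; rewrite -[X in measurable X]setTI; exact: mC. Qed.

(** The masses [c * p j] add up to [c], the mass of the event that [C] is in [D]; hence on that
    event [Y] is almost surely one of the [y j]. *)
Lemma prob_atoms (F : set Omega) : measurable F ->
  fine (P (C @^-1` D `&` F)) =
  \sum_j fine (P (C @^-1` D `&` F `&` Y @^-1` [set y j])).
Proof.
move=> mF; pose s := [seq y j | j <- enum 'I_J].
have us : uniq s by rewrite map_inj_uniq// enum_uniq.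
have ms : measurable (Y @^-1` [set` s]).
  by rewrite -[X in measurable X]setTI; apply: mY => //; exact: measurable_set_mem.
rewrite (prob_setI_full (mpreC mD) ms mF).
  rewrite prob_partition ?big_map ?big_enum//.
  by apply: measurableI => //; exact: mpreC.
rewrite prob_partition ?big_map ?big_enum//=; last exact: mpreC.
by rewrite (eq_bigr (fun j => c * p j))// -mulr_sumr p_sum mulr1.
Qed.

(** The conditioning variable is kept abstract so that one argument covers both uses: a coupling,
    where [C] is A and [D] is everything, and [Theta_I], where [C] is (X, A) and [D] says that X
    equals [x]. In both, [a] reads A off [C]. *)
Lemma lp_feasible_of_restrictions : (0 < T)%N ->
  quantile_restrictions (qconst tau) P Z (a \o C) C ->
  lp_feasible tau theta x y p.
Proof.
move=> T_gt0 [hle [hlt [hleP hltP hq]]].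
have mle l t : measurable [set w | Z l t w <= (a \o C) w].
  have := measurable_fun_ler (mZ l t) (measurableT_comp ma mC).
  move=> /(_ measurableT [set true]); rewrite setTI; exact.
have mlt l t : measurable [set w | Z l t w < (a \o C) w].
  have := measurable_fun_ltr (mZ l t) (measurableT_comp ma mC).
  move=> /(_ measurableT [set true]); rewrite setTI; exact.
have PZle l t B : measurable B -> qconst tau l * fine (P (C @^-1` B)) <=
    fine (P ([set w | Z l t w <= (a \o C) w] `&` C @^-1` B)).
  move=> mB; apply: (cond_prob_ge mC (hleP l t)) => //.
  by apply: filterS hq => w /(_ l t)[].
have PZlt l t B : measurable B ->
    fine (P ([set w | Z l t w < (a \o C) w] `&` C @^-1` B)) <=
    qconst tau l * fine (P (C @^-1` B)).
  move=> mB; apply: (cond_prob_le mC (hltP l t)) => //.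
  by apply: filterS hq => w /(_ l t)[].
rewrite /lp_feasible; set v := breakpoints theta x y.
have zv l t j : zval theta l t (y j) x \in v by exact: mem_breakpoints.
have [b bv] := exists_lt_seq v.
pose fl := seq_floor b v \o a.
have mfl : measurable_fun [set: S] fl.
  by apply: measurableT_comp => //; exact: measurable_seq_floor.
have mcell e : measurable (fl @^-1` [set e]).
  by rewrite -[X in measurable X]setTI; exact: mfl.
(* The cell on which [C] lies in [D] and A has floor [e]. It is an event about [C], so the
   restrictions can be integrated over it. *)
pose K e := C @^-1` (D `&` fl @^-1` [set e]).
have mKD e : measurable (D `&` fl @^-1` [set e]) by exact: measurableI.
have mK e : measurable (K e) by exact: mpreC.
have Katoms e F : measurable F ->
    fine (P (F `&` K e)) = \sum_j fine (P (F `&` K e `&` Y @^-1` [set y j])).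
  move=> mF; rewrite /K preimage_setI setICA prob_atoms//.
  by apply: measurableI => //; exact: mpreC.
have KE e w j : (K e `&` Y @^-1` [set y j]) w -> 
    [/\ D (C w), seq_floor b v (a (C w)) = e & Y w = y j].
  by move=> [[]].
(* On [K b] no breakpoint is at most A, so the event of the median restriction is null there, while
   half the mass of [K b] bounds it from below. A coordinate [t] must exist, whence [T_gt0]. *)
have Kb : fine (P (K b)) = 0.
  have := PZle ord0 (Ordinal T_gt0) _ (mKD b).
  rewrite -/(K b) Katoms// big1 => [|j _].
    rewrite /qconst eqxx pmulr_rle0; last lra.
    by move=> Kle0; apply/eqP; rewrite eq_le Kle0 prob_ge0.
  rewrite (_ : _ `&` _ = set0) ?measure0//; apply/seteqP; split=> // w.
  rewrite -setIA => -[/= Zle /KE[Dw fw Yw]]; move: Zle; rewrite ZE// Yw => Zle.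
  have := le_seq_floor b (zv _ _ _) Zle.
  by rewrite fw leNgt bv.
have bnv : b \notin v by apply/negP => /bv; rewrite ltxx.
have uv : uniq (b :: v) by rewrite /= bnv breakpoints_uniq.
(* The solution: the joint mass of the atom [y j] and the floor [e], conditional on [C] being in
   [D]. *)
pose q j e := fine (P (K e `&` Y @^-1` [set y j])) / c.
(* Equality holds here: a breakpoint is at most A if and only if it is at most the floor of A. *)
have Kle l t j e : e \in v ->
    fine (P ([set w | Z l t w <= (a \o C) w] `&` K e `&` Y @^-1` [set y j])) =
    c * (q j e * (zval theta l t (y j) x <= e)%R%:R).
  move=> ev; rewrite mulrA (mulrC c) divfK ?gt_eqF// -setIA.
  have [ze|ze] := leP (zval theta l t (y j) x) e.
    rewrite mulr1 setIidr// => w /KE[Dw fw Yw] /=; rewrite ZE// Yw.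
    rewrite (le_trans ze)// -fw seq_floor_le// fw.
    by apply: contraNneq bnv => <-.
  rewrite mulr0 (_ : _ `&` _ = set0) ?measure0//; apply/seteqP; split=> // w.
  move=> -[/= Zle /KE[Dw fw Yw]]; move: Zle; rewrite ZE// Yw => Zle.
  have := le_seq_floor b (zv _ _ _) Zle.
  by rewrite fw leNgt ze.
(* Only an inequality holds here, since a breakpoint equal to the floor may lie strictly below A;
   the upper bound on the strict event needs just this direction. *)
have Klt l t j e : c * (q j e * (zval theta l t (y j) x < e)%R%:R) <=
    fine (P ([set w | Z l t w < (a \o C) w] `&` K e `&` Y @^-1` [set y j])).
  rewrite mulrA (mulrC c) divfK ?gt_eqF//.
  have [ze|ze] := ltP (zval theta l t (y j) x) e; last by rewrite mulr0 prob_ge0.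
  rewrite mulr1 -setIA [X in _ <= fine (P X)]setIidr// => w /KE[Dw fw Yw] /=.
  rewrite ZE// Yw (lt_le_trans ze)// -fw seq_floor_le// fw.
  by rewrite gt_eqF// (le_lt_trans _ ze)// ltW// bv.
have KT e : fine (P (K e)) = c * \sum_j q j e.
  rewrite -[in LHS](setTI (K e)) Katoms// mulr_sumr; apply: eq_bigr => j _.
  by rewrite setTI mulrC divfK ?gt_eqF.
exists (fun j s => q j v`_s); split.
- by move=> j s; rewrite divr_ge0 ?prob_ge0// ltW.
- move=> j; rewrite -(big_mkord xpredT (fun s => q j v`_s)) -(big_nth 0 xpredT (q j)).
  apply: (mulfI (lt0r_neq0 c_gt0)); rewrite -Pp mulr_sumr.
  have mG : measurable (C @^-1` D `&` Y @^-1` [set y j]).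
    by apply: measurableI => //; exact: mpreC.
  (* The floor takes its values in [b :: v], so the cells of these values split the event; the cell
     of [b] is then discarded by [Kb]. *)
  have := prob_partition P mG (measurableT_comp mfl mC) (@measurable_set1 R) uv.
  rewrite [X in _ `&` X](_ : _ = setT) ?setIT => [->|]; last first.
    by apply/seteqP; split=> // w _; exact: seq_floor_mem.
  have cell e : C @^-1` D `&` Y @^-1` [set y j] `&` (fl \o C) @^-1` [set e] =
      K e `&` Y @^-1` [set y j] by rewrite setIAC.
  rewrite big_cons cell (_ : fine (P _) = 0) ?add0r; last first.
    apply/eqP; rewrite eq_le prob_ge0 -Kb andbT prob_le//.
    exact: measurableI.
  by apply: eq_bigr => e _; rewrite cell mulrC divfK ?gt_eqF.
(* Multiplied by [c], the constraint becomes the restriction integrated over the cell of the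
   breakpoint, by [Kle] and [KT]. *)
- move=> l t s; rewrite -(pmulr_rge0 _ c_gt0) mulr_sumr.
  under eq_bigr => j _ do rewrite mulrBr mulrBr -Kle ?mem_nth// (mulrC (q _ _)).
  rewrite sumrB -Katoms// subr_ge0 -mulr_sumr -mulr_sumr mulrCA -KT.
  exact: PZle.
- move=> l t s; rewrite -(pmulr_rge0 _ c_gt0) mulr_sumr.
  under eq_bigr => j _ do rewrite mulrBr mulrBr (mulrC (q _ _) (qconst _ _)).
  rewrite sumrB subr_ge0 -2![in leRHS]mulr_sumr mulrCA -KT.
  apply: le_trans (PZlt l t _ (mKD v`_s)).
  by rewrite -/(K _) Katoms//; apply: ler_sum.
Qed.

End Necessity.

(** * Finitely supported measures as lists of weighted points *)

Lemma indic_set1 (R : realType) (S : choiceType) (a u : S) :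
  \1_[set a] u = (u == a)%:R :> R.
Proof.
rewrite indicE; congr (nat_of_bool _)%:R.
by apply/idP/eqP; rewrite inE.
Qed.

Section AtomicMeasure.
Context (R : realType) d (Omega : measurableType d).

(** A sum of scaled Dirac masses, added one at a time along the list. The integral formula goes
    through the same induction, because the measure is known afterwards only by these two
    properties. *)
Lemma exists_atomic_measure (s : seq (R * Omega)) :
  (forall e, e \in s -> 0 <= e.1) ->
  exists m : {measure set Omega -> \bar R},
    (forall E, m E = (\sum_(e <- s) e.1 * \1_E e.2)%:E) /\
    forall D (f : Omega -> R), measurable D -> measurable_fun [set: Omega] f ->
      (forall w, 0 <= f w) ->
      (\int[m]_(w in D) (f w)%:E =
       (\sum_(e <- s) e.1 * \1_D e.2 * f e.2)%R%:E)%E.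
Proof.
elim: s => [_|e s IHs s_ge0].
  exists mzero; split => [E|D f mD mf f0]; first by rewrite big_nil.
  by rewrite integral_measure_zero big_nil.
have [|m [mE mint]] := IHs.
  by move=> e' e's; apply: s_ge0; rewrite inE e's orbT.
have e_ge0 : 0 <= e.1 by apply: s_ge0; rewrite mem_head.
exists (measure_add (mscale (NngNum e_ge0) (dirac e.2)) m); split=> [E|D f mD mf f0].
  by rewrite [LHS]measure_addE mE big_cons EFinD EFinM.
have mfD : measurable_fun D (fun w => (f w)%:E).
  exact/measurable_EFinP/measurable_funTS.
have fD_ge0 w : D w -> (0 <= (f w)%:E)%E by rewrite lee_fin.
rewrite ge0_integral_measure_add// ge0_integral_mscale// integral_dirac//.
by rewrite mint// big_cons EFinD -mulrA !EFinM.
Qed.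

Lemma exists_atomic_probability (s : seq (R * Omega)) :
  (forall e, e \in s -> 0 <= e.1) -> \sum_(e <- s) e.1 = 1 ->
  exists P : probability Omega R,
    (forall E, P E = (\sum_(e <- s) e.1 * \1_E e.2)%:E) /\
    forall D (f : Omega -> R), measurable D -> measurable_fun [set: Omega] f ->
      (forall w, 0 <= f w) ->
      (\int[P]_(w in D) (f w)%:E =
       (\sum_(e <- s) e.1 * \1_D e.2 * f e.2)%R%:E)%E.
Proof.
move=> s_ge0 s1; have [m [mE mint]] := exists_atomic_measure s_ge0.
have mT : m setT = 1%E.
  by rewrite mE -s1; congr EFin; apply: eq_bigr => e _; rewrite indicT mulr1.
(* The total mass is already one; normalising changes no value and only supplies the structure of a
   probability. *)
have nE E : mnormalize m (dirac point) E = m E.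
  by rewrite /mnormalize mT onee_eq0/= invr1 mule1.
exists (mnormalize m (dirac point)); split=> [E|D f mD mf f0].
  by rewrite [LHS]nE mE.
by rewrite -mint//; apply: eq_measure_integral => A _ _; exact: nE.
Qed.

End AtomicMeasure.

(** * Conditional probabilities under a finitely supported law *)

Section AtomicRestrictions.
Context (R : realType) d d' (Omega : measurableType d) (S : measurableType d').
Variables (C : Omega -> S) (s : seq (R * Omega)) (P : probability Omega R).
Hypotheses (mC : measurable_fun [set: Omega] C)
  (mS : forall a : S, measurable [set a])
  (s_ge0 : forall e, e \in s -> 0 <= e.1)
  (PE : forall E, P E = (\sum_(e <- s) e.1 * \1_E e.2)%:E)
  (Pint : forall D (f : Omega -> R), measurable D ->
     measurable_fun [set: Omega] f -> (forall w, 0 <= f w) ->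
     (\int[P]_(w in D) (f w)%:E =
      (\sum_(e <- s) e.1 * \1_D e.2 * f e.2)%R%:E)%E).

Let mpreC B : measurable B -> measurable (C @^-1` B).
Proof. by move=> mB; rewrite -[X in measurable X]setTI; exact: mC. Qed.

Let mass (u : S) : R := \sum_(e <- s | C e.2 == u) e.1.

Let mass_ge e : e \in s -> e.1 <= mass (C e.2).
Proof.
move=> es; rewrite /mass (big_rem e)//= eqxx lerDl big_seq_cond sumr_ge0//.
by move=> f /andP[/mem_rem fs _]; exact: s_ge0.
Qed.

(** The ratio of the mass of [E] in the fibre over [u] to the mass of that fibre, spread over the
    atoms: each term is a constant times the indicator of a singleton, so measurability in [u] is
    immediate. *)
Definition atomic_cond_prob (E : set Omega) (u : S) : R :=
  \sum_(e <- s) e.1 * \1_E e.2 / mass (C e.2) * \1_[set C e.2] u.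

Lemma atomic_cond_probE E u : atomic_cond_prob E u =
  (\sum_(e <- s | C e.2 == u) e.1 * \1_E e.2) / mass u.
Proof.
rewrite /atomic_cond_prob [in RHS]big_mkcond mulr_suml; apply: eq_bigr => e _.
rewrite indic_set1 eq_sym; case: eqP => [->|_]; first by rewrite mulr1.
by rewrite mulr0 mul0r.
Qed.

Let atomic_ge0 E u : 0 <= atomic_cond_prob E u.
Proof.
rewrite atomic_cond_probE /mass divr_ge0//; rewrite big_seq_cond sumr_ge0// => e /andP[es _].
  by rewrite mulr_ge0// s_ge0.
exact: s_ge0.
Qed.

Lemma atomic_cond_probP E : is_cond_prob P C E (atomic_cond_prob E).
Proof.
have mh : measurable_fun [set: S] (atomic_cond_prob E).
  apply: measurable_sum => e; apply: measurable_funM => //.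
have mhC := measurableT_comp mh mC.
split=> //.
  apply/integrableP; split; first exact/measurable_EFinP.
  under eq_integral do rewrite /= ger0_norm//.
  by rewrite Pint// ltry.
move=> B mB; rewrite Pint//; last exact: mpreC.
rewrite PE; congr EFin.
(* After exchanging the two sums, the outer atoms sharing the fibre of [f] add up to the fibre mass,
   which is to cancel the denominator. *)
transitivity (\sum_(f <- s) f.1 * \1_E f.2 * \1_B (C f.2) / mass (C f.2) *
    mass (C f.2)).
  rewrite /atomic_cond_prob.
  under eq_bigr => e _ do rewrite mulr_sumr.
  rewrite exchange_big; apply: eq_bigr => f _.
  have massE r : r * mass (C f.2) =
      \sum_(e <- s) r * (e.1 * (C e.2 == C f.2)%:R).
    rewrite -mulr_sumr /mass big_mkcond; congr (_ * _); apply: eq_bigr => e _.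
    by case: eqP => _; rewrite ?mulr1 ?mulr0.
  rewrite massE; apply: eq_bigr => e _.
  rewrite indic_set1 (_ : \1_(C @^-1` B) e.2 = \1_B (C e.2))//.
  by case: eqP => [->|_]; rewrite ?mulr1 ?mulr0//; ring.
apply: eq_big_seq => f fs; have f0 := s_ge0 fs.
rewrite indicI/= (_ : \1_(C @^-1` B) f.2 = \1_B (C f.2))// mulrA.
(* In a fibre of mass zero the division does not cancel, but there the weight [f.1] is itself
   zero. *)
have [M0|M0] := eqVneq (mass (C f.2)) 0; last by rewrite divfK.
rewrite (_ : f.1 = 0) ?mul0r//; apply/eqP.
by rewrite eq_le f0 -M0 mass_ge.
Qed.

(** On a fibre of positive mass, multiplying a bound on the ratio by that mass gives the sum
    condition over the fibre. *)
Lemma quantile_restrictions_of_atoms T (q : 'I_2 -> R)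
    (Z : 'I_2 -> 'I_T -> Omega -> R) (A : Omega -> R) :
  (forall l t e, e \in s -> 0 <= \sum_(f <- s | C f.2 == C e.2)
      f.1 * ((Z l t f.2 <= A f.2)%R%:R - q l)) ->
  (forall l t e, e \in s -> 0 <= \sum_(f <- s | C f.2 == C e.2)
      f.1 * (q l - (Z l t f.2 < A f.2)%R%:R)) ->
  quantile_restrictions q P Z A C.
Proof.
move=> Zle Zlt.
exists (fun l t => atomic_cond_prob [set w | Z l t w <= A w]).
exists (fun l t => atomic_cond_prob [set w | Z l t w < A w]).
split; [by move=> l t; exact: atomic_cond_probP..|].
(* The exceptional set: values of [C] reached by no atom of positive weight. Off it the fibre mass
   is positive, so the ratios are genuine. *)
pose N := ~` (C @^-1` [set` [seq C e.2 | e <- s & 0 < e.1]]).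
exists N; split.
- by apply/measurableC/mpreC/measurable_set_mem.
- rewrite PE big1_seq// => e /= es; have [e0|e0] := ltP 0 e.1.
    rewrite indicE memNset ?mulr0//; apply; apply/mapP; exists e => //.
    by rewrite mem_filter e0.
  by rewrite (_ : e.1 = 0) ?mul0r//; apply/eqP; rewrite eq_le e0 s_ge0.
- move=> w /=; apply: contra_notP => /contrapT /mapP[e].
  rewrite mem_filter => /andP[e0 es] -> l t.
  have M0 : 0 < mass (C e.2) by rewrite (lt_le_trans e0)// mass_ge.
  have ind (b : Omega -> bool) f : \1_[set w | b w] f = (b f)%:R :> R.
    by rewrite indicE mem_setE.
  rewrite !atomic_cond_probE ler_pdivlMr// ler_pdivrMr// /mass !mulr_sumr.
  split; rewrite -subr_ge0 -sumrB.
    have := Zle l t e es; congr (0 <= _); apply: eq_bigr => f _.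
    by rewrite ind mulrBr (mulrC (q l)).
  have := Zlt l t e es; congr (0 <= _); apply: eq_bigr => f _.
  by rewrite ind mulrBr (mulrC (q l)).
Qed.

End AtomicRestrictions.

(** * Measurability in the model and the conditional law of Y *)

Section ModelFacts.
Context (R : realType) (T k : nat).
Implicit Types (theta : param R k) (x : covpath R T k) (u : outcome R T).

Lemma measurable_set1_outcome u : measurable [set u].
Proof. exact: (measurable_tuple_set1 u (@measurable_set1 R)). Qed.

Lemma measurable_set1_covpath x : measurable [set x].
Proof.
apply: measurable_tuple_set1 => u.
exact: (measurable_tuple_set1 u (@measurable_set1 R)).
Qed.

Lemma measurable_zval theta l t :
  measurable_fun [set: outcome R T * covpath R T k]
    (fun w => zval theta l t w.1 w.2).
Proof.
have mdot (b : k.-tuple R) : measurable_fun [set: outcome R T * covpath R T k]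
    (fun w => dot (tnth w.2 t) b).
  apply: measurable_sum => i; apply: measurable_funM => //.
  apply: (measurableT_comp (@measurable_tnth _ R k i)).
  exact: (measurableT_comp (@measurable_tnth _ (k.-tuple R) T t)).
have my : measurable_fun [set: outcome R T * covpath R T k] (fun w => tnth w.1 t).
  exact: (measurableT_comp (@measurable_tnth _ R T t)).
case: theta => [[b0 b1] r]; rewrite /zval; case: eqP => _.
  exact: measurable_funB.
by apply: measurable_funM => //; exact: measurable_funB.
Qed.

Variable Pobs : probability (outcome R T * covpath R T k)%type R.

Lemma probXE x : probX Pobs x = fine (Pobs (snd @^-1` [set x])).
Proof. by []. Qed.

Lemma probX_ge0 x : 0 <= probX Pobs x.
Proof. exact: prob_ge0. Qed.

Lemma cond_lawE x B : 0 < probX Pobs x ->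
  fine (Pobs (snd @^-1` [set x] `&` fst @^-1` B)) = probX Pobs x * cond_law Pobs x B.
Proof.
by move=> x_gt0; rewrite setIC mulrC /cond_law divfK ?gt_eqF.
Qed.

(** By [prob_atoms] the listed atoms exhaust the conditional law, so they determine it on every
    measurable set. *)
Lemma cond_law_atoms x J (y : 'I_J -> outcome R T) p B :
  0 < probX Pobs x -> cond_atoms Pobs x y p -> measurable B ->
  cond_law Pobs x B = \sum_j p j * \1_B (y j).
Proof.
move=> x_gt0 [y_inj _ yp p1] mB.
apply: (mulfI (lt0r_neq0 x_gt0)); rewrite -cond_lawE// mulr_sumr.
have mfB : measurable (fst @^-1` B : set (outcome R T * covpath R T k)).
  by rewrite -[X in measurable X]setTI; exact: measurable_fst.
have yq j : fine (Pobs (snd @^-1` [set x] `&` fst @^-1` [set y j])) =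
    probX Pobs x * p j by rewrite cond_lawE// yp.
rewrite (prob_atoms measurable_fst measurable_snd (measurable_set1_covpath x)
  y_inj yq p1 mfB); apply: eq_bigr => j _.
rewrite indicE; have [yB|yB] := boolP (y j \in B).
  rewrite mulr1 -yq -setIA [in LHS](@setIidr _ _ (fst @^-1` [set y j]))//.
  by move=> w /= ->; rewrite -in_setE.
rewrite !mulr0 (_ : _ `&` _ = set0) ?measure0//.
by apply/seteqP; split=> // w [[_ /= Bw] yw]; move/negP: yB; apply; rewrite -yw in_setE.
Qed.

Lemma exists_cond_atoms x : 0 < probX Pobs x -> finite_cond_support Pobs x ->
  exists J (y : 'I_J -> outcome R T) p, cond_atoms Pobs x y p.
Proof.
move=> x_gt0 [U /finite_seqP[s ->{U}] sx1].
pose m u := cond_law Pobs x [set u].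
(* A list of the finite support may contain repetitions and null points, whereas [cond_atoms] asks
   for distinct points of positive mass. The discarded null points do not affect the sum. *)
pose s' := [seq u <- undup s | 0 < m u].
exists (size s'), (tnth (in_tuple s')), (fun j => m (tnth (in_tuple s') j)).
split=> //.
- by apply/tuple_uniqP; rewrite filter_uniq// undup_uniq.
- by move=> j; have := mem_tnth j (in_tuple s'); rewrite mem_filter => /andP[].
rewrite -(big_tnth _ _ s' xpredT m) big_filter big_mkcond/=.
rewrite -sx1 -[RHS](mulKf (lt0r_neq0 x_gt0)) -cond_lawE//.
have -> : [set` s] = [set` undup s].
  by apply/seteqP; split=> u /=; rewrite mem_undup.
rewrite prob_partition ?undup_uniq//; last 2 first.
- by rewrite -[X in measurable X]setTI; apply: measurable_snd => //; exact: measurable_set1_covpath.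
- exact: measurable_set1_outcome.
rewrite mulr_sumr; apply: eq_bigr => u _; rewrite cond_lawE// mulKf ?gt_eqF//.
case: ltP => // m0; apply/eqP; rewrite eq_le m0 andbT.
by rewrite divr_ge0// ?prob_ge0// ltW.
Qed.

End ModelFacts.

(** The list gives weight [q j i] to the outcome [y j] paired with the breakpoint of index [i]. The
    sums over the fibre of a real [a] gather the constraints of the breakpoints equal to [a], and
    are empty when there is none. *)
Lemma atoms_of_lp_feasible (R : realType) T k tau (theta : param R k) x J
    (y : 'I_J -> outcome R T) p : lp_feasible tau theta x y p ->
  exists s : seq (R * (outcome R T * R)),
  [/\ forall e, e \in s -> 0 <= e.1,
      forall B, \sum_(e <- s) e.1 * \1_B e.2.1 = \sum_j p j * \1_B (y j),
      forall l t a, 0 <= \sum_(e <- s | e.2.2 == a)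
        e.1 * ((zval theta l t e.2.1 x <= e.2.2)%R%:R - qconst tau l) &
      forall l t a, 0 <= \sum_(e <- s | e.2.2 == a)
        e.1 * (qconst tau l - (zval theta l t e.2.1 x < e.2.2)%R%:R)].
Proof.
rewrite /lp_feasible; set v := breakpoints _ _ _ => -[q [q_ge0 qp qle qlt]].
exists [seq (q j i, (y j, v`_i)) | j <- enum 'I_J, i <- enum 'I_(size v)].
split.
- by move=> e /allpairsP[[j i] [_ _ ->]]; exact: q_ge0.
- move=> B; rewrite big_allpairs_dep big_enum; apply: eq_bigr => j _.
  by rewrite big_enum/= -mulr_suml qp.
- move=> l t a; rewrite big_mkcond big_allpairs_dep exchange_big big_enum/= sumr_ge0// => i _.
  rewrite big_enum/=; have [_|_] := eqVneq v`_i a; first exact: qle.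
  by rewrite big1.
- move=> l t a; rewrite big_mkcond big_allpairs_dep exchange_big big_enum/= sumr_ge0// => i _.
  rewrite big_enum/=; have [_|_] := eqVneq v`_i a; first exact: qlt.
  by rewrite big1.
Qed.

(** * Both directions, for couplings and for the identified set *)

Section Equivalences.
Context (R : realType) (T k : nat) (tau : R) (theta : param R k).
Variable Pobs : probability (outcome R T * covpath R T k)%type R.
Hypothesis T_gt0 : (0 < T)%N.

Lemma joint_coupling_lp_feasible x J (y : 'I_J -> outcome R T) p
    (pi : probability (outcome R T * R)%type R) :
  0 < probX Pobs x -> cond_atoms Pobs x y p ->
  joint_coupling tau Pobs x theta pi -> lp_feasible tau theta x y p.
Proof.
move=> x_gt0 [y_inj _ yp p1] [piY piq].
have piT : fine (pi (snd @^-1` setT)) = 1.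
  by rewrite preimage_setT probability_setT.
apply: (lp_feasible_of_restrictions (a := id) (D := setT) measurable_fst
  measurable_snd _ _ _ _ _ y_inj _ p1 T_gt0 piq) => //.
- move=> l t; have mx : measurable_fun setT (fun w : outcome R T * R => (w.1, x)).
    exact: measurable_fun_pair.
  exact: (measurableT_comp (measurable_zval theta l t) mx).
- by rewrite piT.
- move=> j; rewrite piT mul1r -yp -[RHS]/(fine (_%:E)) -piY; last first.
    exact: measurable_set1_outcome.
  by congr (fine (pi _)); apply/seteqP; split=> w [].
Qed.

Lemma Theta_I_lp_feasible x J (y : 'I_J -> outcome R T) p :
  Theta_I tau Pobs theta ->
  0 < probX Pobs x -> cond_atoms Pobs x y p -> lp_feasible tau theta x y p.
Proof.
move=> [_ [pi [piYX piq]]] x_gt0 [y_inj _ yp p1].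
pose C (w : outcome R T * covpath R T k * R) := (w.1.2, w.2).
have mC : measurable_fun setT C.
  apply: measurable_fun_pair => //.
  exact: (measurableT_comp measurable_snd measurable_fst).
have msx : measurable (snd @^-1` [set x] : set (outcome R T * covpath R T k)).
  rewrite -[X in measurable X]setTI; apply: measurable_snd => //.
  exact: measurable_set1_covpath.
have piC : fine (pi (C @^-1` (fst @^-1` [set x]))) = probX Pobs x.
  rewrite probXE -piYX//; congr (fine (pi _)).
  by apply/seteqP; split=> [w //|w []].
have mYfst : measurable_fun setT (fst \o fst : outcome R T * covpath R T k * R -> _).
  exact: (measurableT_comp measurable_fst measurable_fst).
(* Localising to the event that X equals [x] makes the normalising constant [c] equal to
   [probX Pobs x], and the conditional atoms have joint mass [c * p j]. *)
apply: (lp_feasible_of_restrictions (a := snd) (D := fst @^-1` [set x]) mYfst mC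
  measurable_snd _ _ _ _ y_inj _ p1 T_gt0 piq) => //.
- rewrite -[X in measurable X]setTI; apply: measurable_fst => //.
  exact: measurable_set1_covpath.
- by move=> l t; apply: (measurableT_comp (measurable_zval theta l t)).
- by move=> l t w /= ->.
- by rewrite piC.
- move=> j; rewrite piC -yp -cond_lawE// -piYX.
    by congr (fine (pi _)); apply/seteqP; split=> [w []|w [[]]].
  apply: measurableI => //; rewrite -[X in measurable X]setTI.
  by apply: measurable_fst => //; exact: measurable_set1_outcome.
Qed.

Lemma lp_feasible_joint_coupling x J (y : 'I_J -> outcome R T) p :
  0 < probX Pobs x -> cond_atoms Pobs x y p -> lp_feasible tau theta x y p ->
  exists pi : probability (outcome R T * R)%type R,
    joint_coupling tau Pobs x theta pi.
Proof.
move=> x_gt0 yp /atoms_of_lp_feasible[s [s_ge0 sY sle slt]].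
have s1 : \sum_(e <- s) e.1 = 1.
  transitivity (\sum_(e <- s) e.1 * \1_[set: outcome R T] e.2.1).
    by apply: eq_bigr => e _; rewrite indicT mulr1.
  case: yp => _ _ _ <-; rewrite sY; apply: eq_bigr => j _.
  by rewrite indicT mulr1.
have [pi [piE piint]] := exists_atomic_probability s_ge0 s1.
exists pi; split.
  move=> B mB; rewrite piE (cond_law_atoms x_gt0 yp mB) -sY; congr EFin.
  apply: eq_bigr => e _; congr (_ * _); rewrite !indicE; congr (nat_of_bool _)%:R.
  by apply/idP/idP; rewrite !inE; [case|].
apply: (quantile_restrictions_of_atoms measurable_snd (@measurable_set1 R)
  s_ge0 piE piint) => l t e _; [exact: sle|exact: slt].
Qed.

Lemma lp_feasible_Theta_I : 0 < theta.2 -> finite_support_X Pobs ->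
  (forall x, 0 < probX Pobs x -> finite_cond_support Pobs x) ->
  (forall x, 0 < probX Pobs x ->
    forall J (y : 'I_J -> outcome R T) p,
      cond_atoms Pobs x y p -> lp_feasible tau theta x y p) ->
  Theta_I tau Pobs theta.
Proof.
move=> r_gt0 [U /finite_seqP[xs ->{U}] xs1] fin_supp lp; split=> //.
(* A list is chosen for every path, null ones included. The marginal identity carries the factor
   [probX Pobs x], so that the empty list satisfies it for a null path. *)
have /choice[g gP] x : exists s : seq (R * (outcome R T * R)),
  [/\ forall e, e \in s -> 0 <= e.1,
      forall B, measurable B -> probX Pobs x * \sum_(e <- s) e.1 * \1_B e.2.1 =
        fine (Pobs (snd @^-1` [set x] `&` fst @^-1` B)),
      forall l t a, 0 <= \sum_(e <- s | e.2.2 == a)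
        e.1 * ((zval theta l t e.2.1 x <= e.2.2)%R%:R - qconst tau l) &
      forall l t a, 0 <= \sum_(e <- s | e.2.2 == a)
        e.1 * (qconst tau l - (zval theta l t e.2.1 x < e.2.2)%R%:R)].
  have [x_gt0|x_le0] := ltP 0 (probX Pobs x).
    have [J [y [p yp]]] := exists_cond_atoms x_gt0 (fin_supp x x_gt0).
    have [s [s_ge0 sY sle slt]] := atoms_of_lp_feasible (lp x x_gt0 J y p yp).
    exists s; split=> // B mB.
    by rewrite sY -(cond_law_atoms x_gt0 yp mB) cond_lawE.
  exists [::]; split=> [//|B mB|l t a|l t a]; rewrite big_nil ?mulr0//.
  apply/esym/eqP; rewrite eq_le prob_ge0 andbT (le_trans _ x_le0)//.
  have msx : measurable (snd @^-1` [set x] : set (outcome R T * covpath R T k)).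
    rewrite -[X in measurable X]setTI; apply: measurable_snd => //.
    exact: measurable_set1_covpath.
  apply: prob_le => //.
  apply: measurableI => //.
  by rewrite -[X in measurable X]setTI; exact: measurable_fst.
(* The mixture of the chosen laws with weights P(X = x); removing duplicates from [xs] prevents a
   path from being counted twice. *)
pose s := [seq (probX Pobs x * e.1, (e.2.1, x, e.2.2)) | x <- undup xs, e <- g x].
have s_ge0 e : e \in s -> 0 <= e.1.
  move=> /allpairsPdep[x [f [_ fg ->]]]; rewrite /= mulr_ge0 ?probX_ge0//.
  by have [+ _ _ _] := gP x; apply.
have msection (B : set (outcome R T * covpath R T k)) x :
    measurable B -> measurable [set u | B (u, x)].
  by move=> /(measurable_ysection x); rewrite ysectionE.
have msnd (B : set (covpath R T k)) : measurable B ->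
    measurable (snd @^-1` B : set (outcome R T * covpath R T k)).
  by move=> mB; rewrite -[X in measurable X]setTI; exact: measurable_snd.
have xs_undup : [set` xs] = [set` undup xs].
  by apply/seteqP; split=> u /=; rewrite mem_undup.
have sB B : measurable B -> \sum_(e <- s) e.1 * \1_(B `*` setT) e.2 = fine (Pobs B).
  move=> mB; rewrite big_allpairs_dep.
  have mxs : measurable (snd @^-1` [set` undup xs] : set (outcome R T * covpath R T k)).
    apply: msnd; apply: measurable_set_mem => x.
    exact: measurable_set1_covpath.
  have Pxs : fine (Pobs (setT `&` snd @^-1` [set` undup xs])) = fine (Pobs setT).
    by rewrite setTI -xs_undup probability_setT; exact: (congr1 fine xs1).
  rewrite -[in RHS](setTI B) (prob_setI_full measurableT mxs mB Pxs) setTI.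
  rewrite prob_partition ?undup_uniq//; last exact: measurable_set1_covpath.
  apply: eq_bigr => x _; have [_ gB _ _] := gP x.
  (* For a fixed path only the section of [B] at [x] matters, which reduces the claim to the
     marginal identity of [g x]. *)
  transitivity (probX Pobs x * \sum_(e <- g x) e.1 * \1_[set u | B (u, x)] e.2.1).
    rewrite mulr_sumr; apply: eq_bigr => e _; rewrite -mulrA; congr (_ * (_ * _)).
    rewrite !indicE; congr (nat_of_bool _)%:R.
    by apply/idP/idP; rewrite !inE; [case|].
  rewrite gB; last exact: msection.
  congr (fine (Pobs _)); apply/seteqP; split=> -[u x'] /= [].
    by move=> ->.
  by move=> Bux <-.
have s1 : \sum_(e <- s) e.1 = 1.
  have := sB setT measurableT; rewrite probability_setT/= => <-.
  by apply: eq_bigr => e _; rewrite setXTT indicT mulr1.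
have [pi [piE piint]] := exists_atomic_probability s_ge0 s1.
exists pi; split.
  by move=> B mB; rewrite piE sB// fineK// fin_num_measure.
have mC : measurable_fun [set: outcome R T * covpath R T k * R]
    (fun w => (w.1.2, w.2)).
  apply: measurable_fun_pair => //.
  exact: (measurableT_comp measurable_snd measurable_fst).
have mset1C (u : covpath R T k * R) : measurable [set u].
  apply: measurable_pair_set1; first exact: measurable_set1_covpath.
  exact: measurable_set1.
(* the atoms sharing the conditioning value (x, a) are those built from [g x] *)
have fibre (F : R -> outcome R T -> covpath R T k -> R -> R) x a :
    (forall r u x' b, F (probX Pobs x' * r) u x' b = probX Pobs x' * F r u x' b) ->
    0 <= \sum_(e <- g x | e.2.2 == a) F e.1 e.2.1 x e.2.2 ->
    0 <= \sum_(f <- s | (f.2.1.2, f.2.2) == (x, a)) F f.1 f.2.1.1 f.2.1.2 f.2.2.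
  move=> FM Fge0; rewrite big_mkcond big_allpairs_dep sumr_ge0// => x' _ /=.
  rewrite -big_mkcond/=; have [->|xx'] := eqVneq x' x.
    under eq_bigl => e do rewrite xpair_eqE eqxx.
    by under eq_bigr => e _ do rewrite FM; rewrite -mulr_sumr mulr_ge0 ?probX_ge0.
  by rewrite big1// => e; rewrite xpair_eqE (negbTE xx').
apply: (quantile_restrictions_of_atoms mC mset1C s_ge0 piE piint) => l t e _.
  apply: (fibre (fun r u x a => r * ((zval theta l t u x <= a)%R%:R - qconst tau l))).
    by move=> *; rewrite mulrA.
  by have [_ _ + _] := gP e.2.1.2; apply.
apply: (fibre (fun r u x a => r * (qconst tau l - (zval theta l t u x < a)%R%:R))).
  by move=> *; rewrite mulrA.
by have [_ _ _] := gP e.2.1.2; apply.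
Qed.

End Equivalences.

Theorem theorem8p9 (R : realType) (T k : nat) (hT : (1 <= T)%N)
    (hk : (1 <= k)%N) (tau : R) (tau_gt0 : 0 < tau) (tau_lt1 : tau < 1)
    (tau_neq : tau <> 1 / 2)
    (Pobs : probability (outcome R T * covpath R T k)%type R)
    (b0 b1 : k.-tuple R) (r : R) (r_gt0 : 0 < r) :
  (forall (x : covpath R T k) (J : nat) (y : 'I_J -> outcome R T) (p : 'I_J -> R),
     0 < probX Pobs x -> cond_atoms Pobs x y p ->
     ((exists pi : probability (outcome R T * R)%type R,
         joint_coupling tau Pobs x (b0, b1, r) pi) <->
      lp_feasible tau (b0, b1, r) x y p))
  /\
  (finite_support_X Pobs ->
   (forall x : covpath R T k, 0 < probX Pobs x -> finite_cond_support Pobs x) ->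
   (Theta_I tau Pobs (b0, b1, r) <->
    forall x : covpath R T k, 0 < probX Pobs x ->
      forall (J : nat) (y : 'I_J -> outcome R T) (p : 'I_J -> R),
        cond_atoms Pobs x y p -> lp_feasible tau (b0, b1, r) x y p)).
Proof.
split=> [x J y p x_gt0 yp|finX fin_cond].
  split=> [[pi]|]; first exact: joint_coupling_lp_feasible.
  exact: lp_feasible_joint_coupling.
split=> [theta_in x x_gt0 J y p|]; first exact: Theta_I_lp_feasible.
exact: lp_feasible_Theta_I.
Qed.
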